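(* Let $p,q$ be prime numbers with $q-p=2$, let $E$ be the elliptic curve $y^2=x(x+p)(x+q)$, and let $K=\mathbf{Q}(\sqrt{-1})$. Consider the system of Diophantine equations in integers $X,Y,S,T$: $$\text{(I)}\quad X^2-pY^2=S^2,\qquad X^2-qY^2=-T^2.$$ Let $n_{2K}^-=\tfrac12\,\#\bigl(2E(K)\cap E(\mathbf{Q})^-\bigr)$ and let $n(I)$ be the number of positive primary solutions of (I) (both are possibly infinite). Then: (3.1) If $n_{2K}^-\neq 0$, then (I) has a primary solution. (3.2) $n_{2K}^-\le n(I)$. In particular, if $n_{2K}^-=\infty$, then (I) has infinitely many primary solutions.
   Context: $E(\mathbf{Q})^-=\{(x,y)\in E(\mathbf{Q}) : x<0\}$ is the set of affine rational points of $E$ with negative $x$-coordinate. $2E(K)=\{2P : P\in E(K)\}$ is the image of multiplication by $2$ on the Mordell-Weil group $E(K)$. A primary solution of (I) is an integer solution $(X,Y,S,T)\in\mathbf{Z}^4$ with $\gcd(X,Y)=1$ and $XY\neq0$; it is positive if $X,Y,S,T$ are all positive. *)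

(* Defs.v *)
From HB Require Import structures.
From mathcomp Require Import all_boot all_order all_algebra all_field.
From mathcomp Require Import finmap boolp classical_sets functions cardinality.
From mathcomp Require Import constructive_ereal.

Set Implicit Arguments.
Unset Strict Implicit.
Unset Printing Implicit Defensive.

Import Order.TTheory GRing.Theory Num.Theory.

Local Open Scope classical_set_scope.
Local Open Scope ring_scope.

(* The field Q(sqrt(-1)), as Q[X]/(X^2 + 1). *)
Lemma Xsqr1_monic_irreducible :
  monic_irreducible_poly ('X^2 + 1 : {poly rat}).
Proof.
have -> : 'X^2 + 1 = 'X^2 + 1%:P :> {poly rat} by [].
split; last by rewrite monicE lead_coefDl ?lead_coefXn// size_polyXn size_polyC.
apply: cubic_irreducible; first by rewrite size_polyDl ?size_polyXn ?size_polyC.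
move=> x; rewrite /root !hornerE gt_eqF//.
by rewrite ltr_wpDl// sqr_ge0.
Qed.

Definition Qi : fieldType :=
  {poly %/ ('X^2 + 1 : {poly rat}) with Xsqr1_monic_irreducible}.

(* [None] is the point at infinity, [Some (x, y)] an affine point. *)
Definition point (F : Type) : Type := option (F * F).

Definition map_point (F G : Type) (f : F -> G) : point F -> point G :=
  omap (fun P => (f P.1, f P.2)).

Section Curve.
Variables (F : fieldType) (a b : F).

(* E(F) for the curve E : y^2 = x (x + a) (x + b). *)
Definition curve : set (point F) :=
  [set P | if P is Some (x, y) then y ^+ 2 = x * (x + a) * (x + b) else True].

(* The chord-tangent law for y^2 = x^3 + (a + b) x^2 + a b x; it is meaningful
   for points of [curve] only. *)
Definition slope (x1 y1 x2 y2 : F) : F :=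
  if x1 == x2 then (3 * x1 ^+ 2 + 2 * (a + b) * x1 + a * b) / (2 * y1)
  else (y2 - y1) / (x2 - x1).

Definition addp (P Q : point F) : point F :=
  match P, Q with
  | None, _ => Q
  | _, None => P
  | Some (x1, y1), Some (x2, y2) =>
    if (x1 == x2) && (y1 == - y2) then None
    else let l := slope x1 y1 x2 y2 in
         let x3 := l ^+ 2 - (a + b) - x1 - x2 in
         Some (x3, l * (x1 - x3) - y1)
  end.

Definition curve2 : set (point F) := [set addp P P | P in curve].

End Curve.

(* E(Q)^-: affine rational points with x < 0. *)
Definition curve_neg (a b : rat) : set (point rat) :=
  curve a b `&` [set P | if P is Some (x, _) then x < 0 else False].

(* Number of elements of a set, +oo for an infinite set. *)
Definition ecard (T : choiceType) (A : set T) : \bar rat :=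
  if `[< finite_set A >] then (#|` fset_set A|%fset%:R)%:E else +oo%E.

Section System.
Variables p q : nat.

(* The intersection of 2E(K) and E(Q)^- inside E(K), where K = Q(i) and E(Q)
   is embedded in E(K) along Q -> Q(i). *)
Definition double_neg_points : set (point Qi) :=
  curve2 (p%:R : Qi) q%:R
  `&` [set map_point (in_alg Qi) P | P in curve_neg p%:R q%:R].

Definition n2K_neg : \bar rat := ((2^-1)%:E * ecard double_neg_points)%E.

(* Primary solutions (X, Y, Z, W) of X^2 - p Y^2 = Z^2, X^2 - q Y^2 = - W^2. *)
Definition primary_solution (s : int * int * int * int) : Prop :=
  let: (X, Y, Z, W) := s in
  [/\ X ^+ 2 - p%:Z * Y ^+ 2 = Z ^+ 2,
      X ^+ 2 - q%:Z * Y ^+ 2 = - (W ^+ 2),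
      gcdz X Y = 1 & X * Y != 0].

Definition positive_solution (s : int * int * int * int) : Prop :=
  let: (X, Y, Z, W) := s in [/\ 0 < X, 0 < Y, 0 < Z & 0 < W].

Definition nI : \bar rat :=
  ecard [set s | primary_solution s /\ positive_solution s].

End System.

(* Main.v *)
Require Import Defs.
From mathcomp Require Import all_boot all_order all_algebra all_field finmap.
From mathcomp Require Import boolp classical_sets functions cardinality.
From mathcomp Require Import constructive_ereal.
From mathcomp Require Import ring lra.

(** The curve is [y^2 = x (x + p) (x + q)], with three rational points of order
    two, so if [(x, y)] is a double over a field, then [x], [x + p] and [x + q]
    are squares in that field: explicit roots come out of the tangent
    construction ([doubling_squares]).  Over [Q(i)] with [x] rational, each of
    the three is plus or minus the square of a rational, since
    [(c + d i)^2] is rational only if [c d = 0] ([Qi_sqr_rat]).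

    Let moreover [x < 0] and [y] be rational.  Then [x = - r^2], and neither
    [x + p] nor [x + q] vanishes because a prime is not the square of a
    rational.  As [y^2 >= 0], these two have opposite signs, and [p < q], so
    [x + p = - s^2] and [x + q = t^2], that is
    [r^2 - p = s^2] and [r^2 - q = - t^2], and [y] is one of [r s t] and
    [- r s t] ([neg_point_squares]).
    Writing [r = X / Y] in lowest terms and multiplying by [Y^2] yields a
    positive primary solution [(X, Y, S, T)] with [S = s Y] and [T = t Y], and
    [(x, y)] is recovered from it up to the sign of [y].

    The points counted are therefore covered by two images of the set of
    positive primary solutions, one for each sign of [y]
    ([double_neg_points_cover]); all three claims follow by counting
    ([ecard_cover2_le]). *)

Set Implicit Arguments.
Unset Strict Implicit.
Unset Printing Implicit Defensive.

Import Order.TTheory GRing.Theory Num.Theory.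

Local Open Scope classical_set_scope.
Local Open Scope ring_scope.

(** * Counting *)

Lemma ecard_cover2_le (T U : choiceType) (A : set T) (B : set U)
    (f g : T -> U) :
  B `<=` (f @` A) `|` (g @` A) -> ((2^-1)%:E * ecard B <= ecard A)%E.
Proof.
move=> sBA; rewrite {2}/ecard; case: asboolP => [finA|_]; last exact: leey.
have finI h : finite_set (h @` A : set U) by exact: finite_image.
have finU : finite_set ((f @` A) `|` (g @` A)) by rewrite finite_setU.
have finB := sub_finite_set sBA finU.
rewrite /ecard asboolT// -EFinM lee_fin mulrC ler_pdivrMr// -natrM ler_nat.
have := sBA; rewrite (fset_set_sub finB finU) => /fsubset_leq_card.
rewrite fset_setU// !fset_set_image//.
move=> /leq_trans; apply; rewrite muln2 -addnn cardfsU.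
by rewrite (leq_trans (leq_subr _ _))// leq_add// leq_imfset_card.
Qed.

(** * Squares of rational numbers *)

Lemma rat_sqr_int (w : rat) (n : int) :
  w ^+ 2 = n%:~R -> exists m : int, w = m%:~R.
Proof.
move=> w2; exists (numq w); rewrite -[LHS]divq_num_den.
suff -> : denq w = 1 by rewrite divr1.
have/(congr1 absz) : numq w ^+ 2 = n * denq w ^+ 2.
  apply: (@intr_inj rat).
  by rewrite rmorphXn rmorphM rmorphXn/= numqE exprMn w2.
rewrite !(abszM, abszX) => eqn.
(* [denq w] divides [numq w] while being coprime to it, so it is 1. *)
have dvd : (`|denq w| %| `|numq w|)%N.
  by rewrite -(@dvdn_pexp2r _ _ 2)// eqn dvdn_mull.
have := coprime_num_den w.
rewrite /coprime => /eqP; rewrite (gcdn_idPr dvd) => d1.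
by rewrite -(gtz0_abs (denq_gt0 w)) d1.
Qed.

(** A root would be an integer, but the valuation at [p] of a square is even. *)
Lemma prime_not_rat_sqr (p : nat) (r : rat) : prime p -> r ^+ 2 <> p%:R.
Proof.
move=> p_pr r2; have [m rE] := @rat_sqr_int r p%:Z r2.
have/(congr1 absz) : m ^+ 2 = p%:Z.
  by apply: (@intr_inj rat); rewrite rmorphXn/= -rE r2.
rewrite abszX/= => pE; have := lognX p `|m|%N 2.
by rewrite pE logn_prime// eqxx => /(congr1 odd); rewrite oddM.
Qed.

(** * Doubles over Q(i) *)

(** If [z = c + d i], then [z ^+ 2 = (c ^+ 2 - d ^+ 2) + 2 c d i] is rational only
    when [c d = 0].  Which of [c], [d] vanishes decides the sign. *)
Lemma Qi_sqr_rat (r : rat) (z : Qi) :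
  z ^+ 2 = r%:A -> exists2 c : rat, 0 <= c & r = c ^+ 2 \/ r = - c ^+ 2.
Proof.
move=> z2.
suff [c [d [cd0 rE]]] : exists c d : rat, c * d = 0 /\ r = c ^+ 2 - d ^+ 2.
  move/eqP: cd0; rewrite mulf_eq0 => /orP[]/eqP E0; rewrite E0 in rE.
    by exists `|d|; rewrite // real_normK ?num_real//; right; rewrite rE; ring.
  by exists `|c|; rewrite // real_normK ?num_real//; left; rewrite rE; ring.
pose h : {poly rat} := 'X^2 + 1.
have hE : mk_monic h = h := mk_monicE Xsqr1_monic_irreducible.
have sh : size h = 3 by rewrite size_polyDl ?size_polyXn ?size_poly1.
have smk : size (mk_monic h) = 3 by rewrite hE.
have [c [d zE]] : exists c d, (z : {poly rat}) = c%:P + d *: 'X.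
  have sz : (size (z : {poly rat}) <= 2)%N.
    by have := size_mk_monic (h := h) z; rewrite [X in (_ < X)%N]smk.
  exists (z : {poly rat})`_0, (z : {poly rat})`_1.
  apply/polyP => -[|[|i]]; rewrite !coefE/= ?mulr0 ?mulr1 ?addr0 ?add0r//.
  by apply: nth_default; exact: leq_trans sz _.
exists c, d.
have : Pdiv.CommonRing.rmodp ((z : {poly rat}) * z) (mk_monic h) = r *: 1.
  exact: (congr1 (fun t : {poly %/ h} => polyn t) z2).
rewrite zE hE -expr2.
(* Division of [(c + d X)^2] by [X^2 + 1], which is reduction in [Qi]. *)
have -> : (c%:P + d *: 'X) ^+ 2 =
    (d ^+ 2)%:P * h + ((c ^+ 2 - d ^+ 2)%:P + (2 * c * d) *: 'X).
  by rewrite /h -!mul_polyC !(rmorphM, rmorphXn, rmorphB)/=; ring.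
rewrite Pdiv.RingMonic.rmodp_addl_mul_small.
- move=> E; have := congr1 (coefp 0) E; have := congr1 (coefp 1) E.
  rewrite /= !coefE/= => E1 E0; split; lra.
- by case: Xsqr1_monic_irreducible.
- rewrite sh ltnS (leq_trans (size_polyD _ _))// geq_max.
  rewrite (leq_trans (size_polyC_leq1 _))//.
  by rewrite (leq_trans (size_scale_leq _ _))// size_polyX.
Qed.

Lemma Qi_natr (n : nat) : (n%:R : Qi) = in_alg Qi n%:R.
Proof. by rewrite rmorph_nat. Qed.

(** The roots are explicit: if [x] is the abscissa of the double of [(u, v)] and
    [e] runs over [0], [- a] and [- b], then [x - e] is the square of
    [((u - e)^2 - (e - e') (e - e'')) / (2 v)], where [e'] and [e''] are the two
    other values.  The points with [v = 0] double to infinity. *)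
Lemma doubling_squares (F : fieldType) (a b u v x y : F) :
  curve a b (Some (u, v)) ->
  addp a b (Some (u, v)) (Some (u, v)) = Some (x, y) ->
  exists al be ga : F, [/\ x = al ^+ 2, x + a = be ^+ 2 & x + b = ga ^+ 2].
Proof.
rewrite /curve/= => E; rewrite /slope eqxx/=; case: ifPn => // nv [<- _].
have v2 : 2 * v != 0 by rewrite mulr_natl mulr2n addr_eq0.
have [n2 n0] : (2 : F) != 0 /\ v != 0 by move: v2; rewrite mulf_eq0 negb_or => /andP.
exists ((u ^+ 2 - a * b) / (2 * v)),
  ((u ^+ 2 + 2 * a * u + a * b) / (2 * v)),
  ((u ^+ 2 + 2 * b * u + a * b) / (2 * v)).
by split; field: E; rewrite ?n2 ?n0.
Qed.

Lemma half_point_squares (p q : nat) (x : rat) (y : Qi) :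
  double_neg_points p q (Some (in_alg Qi x, y)) ->
  exists r s t : rat, [/\ 0 <= r, 0 <= s & 0 <= t] /\
    [/\ x = r ^+ 2 \/ x = - r ^+ 2,
        x + p%:R = s ^+ 2 \/ x + p%:R = - s ^+ 2 &
        x + q%:R = t ^+ 2 \/ x + q%:R = - t ^+ 2].
Proof.
case=> -[[[u v]|] Euv //] /(doubling_squares Euv).
rewrite !Qi_natr -!rmorphD/= => -[al [be [ga [xE xpE xqE]]]] _.
have [r r0 rE] := Qi_sqr_rat (esym xE).
have [s s0 sE] := Qi_sqr_rat (esym xpE).
have [t t0 tE] := Qi_sqr_rat (esym xqE).
by exists r, s, t.
Qed.

(** * From points to solutions *)

(** Since [x < 0], the sign in [x = r ^+ 2] or [- r ^+ 2] is negative; then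
    [y ^+ 2 = x (x + p) (x + q) >= 0] forces [x + p <= 0 <= x + q], and both
    inequalities are strict because neither [p] nor [q] is a square. *)
Lemma neg_point_squares (p q : nat) (x y : rat) :
  prime p -> prime q -> (p < q)%N ->
  curve_neg p%:R q%:R (Some (x, y)) ->
  double_neg_points p q (map_point (in_alg Qi) (Some (x, y))) ->
  exists r s t : rat, [/\ 0 < r, 0 < s & 0 < t] /\
    [/\ x = - r ^+ 2, r ^+ 2 - p%:R = s ^+ 2, r ^+ 2 - q%:R = - t ^+ 2
      & y = r * s * t \/ y = - (r * s * t)].
Proof.
move=> p_pr q_pr; rewrite -(ltr_nat rat) => pq [/= Exy x_lt0].
move=> /half_point_squares[r [s [t [[r0 s0 t0] [rE sE tE]]]]].
have {}rE : x = - r ^+ 2 by case: rE => // rE; move: (sqr_ge0 r); lra.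
have r2p := @prime_not_rat_sqr p r p_pr.
have r2q := @prime_not_rat_sqr q r q_pr.
have y2 : 0 <= y ^+ 2 := sqr_ge0 y.
have s2 : 0 <= s ^+ 2 := sqr_ge0 s.
have t2 : 0 <= t ^+ 2 := sqr_ge0 t.
have xpD0 : x + p%:R < 0.
  rewrite ltNge; apply/negP => xp.
  have xp' : 0 < x + p%:R by rewrite lt0r xp andbT; apply/eqP; lra.
  have : 0 < (- x) * (x + p%:R) * (x + q%:R).
    by rewrite !mulr_gt0//; lra.
  by move: y2; rewrite Exy; lra.
have xqD0 : 0 < x + q%:R.
  rewrite ltNge; apply/negP => xq.
  have xq' : x + q%:R < 0 by rewrite lt_neqAle xq andbT; apply/eqP; lra.
  have : 0 < (- x) * (- (x + p%:R)) * (- (x + q%:R)).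
    by rewrite !mulr_gt0//; lra.
  by move: y2; rewrite Exy; lra.
have {}sE : x + p%:R = - s ^+ 2 by case: sE => // sE; lra.
have {}tE : x + q%:R = t ^+ 2 by case: tE => // tE; lra.
exists r, s, t; split; split.
- by rewrite lt0r r0 andbT; apply/eqP => r_0; move: rE; rewrite r_0; lra.
- by rewrite lt0r s0 andbT; apply/eqP => s_0; move: sE; rewrite s_0; lra.
- by rewrite lt0r t0 andbT; apply/eqP => t_0; move: tE; rewrite t_0; lra.
- by [].
- lra.
- lra.
- have /eqP : y ^+ 2 = (r * s * t) ^+ 2 by rewrite Exy sE tE rE; ring.
  by rewrite eqf_sqr => /orP[]/eqP; [left|right].
Qed.

(** A solution [(X, Y, Z, W)] determines the point only up to the sign [eps] of
    its ordinate: the abscissa is [- (X / Y) ^+ 2], and the three squares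
    [- x], [- (x + p)], [x + q] have roots [X / Y], [Z / Y], [W / Y]. *)
Definition solution_point (eps : rat) (s : int * int * int * int) :
    Defs.point Qi :=
  let: (X, Y, Z, W) := s in
  map_point (in_alg Qi)
    (Some (- (X%:~R / Y%:~R) ^+ 2,
           eps * (X%:~R * Z%:~R * W%:~R / Y%:~R ^+ 3))).

(** Substituting [r = numq r / denq r] shows that [(s * denq r) ^+ 2] is the
    integer [m * numq r ^+ 2 + n * denq r ^+ 2], and a rational square root of
    an integer is an integer.  So the denominator of [r] also clears that of
    [s]. *)
Lemma denq_clears_sqrt (r s : rat) (m n : int) :
  0 < s -> s ^+ 2 = m%:~R * r ^+ 2 + n%:~R ->
  exists2 k : int, 0 < k & s = k%:~R / (denq r)%:~R.
Proof.
move=> s_gt0 sE.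
have d_gt0 : 0 < (denq r)%:~R :> rat by rewrite ltr0z denq_gt0.
have [k kE] : exists k : int, s * (denq r)%:~R = k%:~R.
  apply: (@rat_sqr_int _ (m * numq r ^+ 2 + n * denq r ^+ 2)).
  by rewrite !(rmorphD, rmorphXn, rmorphM)/= numqE exprMn sE; ring.
exists k; first by rewrite -(ltr0z rat) -kE mulr_gt0.
by rewrite -kE mulfK// gt_eqF.
Qed.

(** Taking for [X / Y] the fraction [r] in lowest terms makes the solution
    primary, and the sign of the ordinate selects the image that contains the
    point. *)
Lemma double_neg_points_cover (p q : nat) :
  prime p -> prime q -> (p < q)%N ->
  double_neg_points p q `<=`
    (solution_point 1 @` [set s | primary_solution p q s /\ positive_solution s])
    `|`
    (solution_point (- 1) @` [set s | primary_solution p q s /\ positive_solution s]).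
Proof.
move=> p_pr q_pr pq P DP; have [_ [[[x y]|] negP PE]] := DP; last by case: negP.
rewrite -PE in DP *.
have [r [s [t [[r0 s0 t0] [xE sE tE yE]]]]] :=
  neg_point_squares p_pr q_pr pq negP DP.
have [S S0 SE] : exists2 S : int, 0 < S & s = S%:~R / (denq r)%:~R.
  apply: (@denq_clears_sqrt r s 1 (- p%:Z) s0).
  by rewrite mul1r rmorphN/= -sE.
have [T T0 TE] : exists2 T : int, 0 < T & t = T%:~R / (denq r)%:~R.
  apply: (@denq_clears_sqrt r t (- 1) q%:Z t0).
  by rewrite rmorphN1 mulN1r -[q%:Z%:~R]/(q%:R); lra.
have d_n0 : (denq r)%:~R != 0 :> rat by rewrite intr_eq0 denq_eq0.
have nE : (numq r)%:~R = r * (denq r)%:~R :> rat := numqE r.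
have rE : r = (numq r)%:~R / (denq r)%:~R by rewrite divq_num_den.
have sol : primary_solution p q (numq r, denq r, S, T) /\
           positive_solution (numq r, denq r, S, T).
  split; last by split; rewrite ?denq_gt0 ?numq_gt0.
  split.
  - apply: (@intr_inj rat); rewrite !(rmorphB, rmorphXn, rmorphM)/= nE.
    rewrite -[p%:Z%:~R]/(p%:R).
    have -> : S%:~R = s * (denq r)%:~R by rewrite SE mulfVK.
    by rewrite [in RHS]exprMn -sE; ring.
  - apply: (@intr_inj rat); rewrite !(rmorphB, rmorphN, rmorphXn, rmorphM)/= nE.
    rewrite -[q%:Z%:~R]/(q%:R).
    have -> : T%:~R = t * (denq r)%:~R by rewrite TE mulfVK.
    by rewrite [in RHS]exprMn -[RHS]mulNr -tE; ring.
  - by apply/eqP; exact: coprime_num_den.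
  - by rewrite mulf_neq0 ?denq_eq0// numq_eq0 gt_eqF.
have yE' : r * s * t =
    (numq r)%:~R * S%:~R * T%:~R / (denq r)%:~R ^+ 3.
  by rewrite {1}rE SE TE; field.
by case: yE => yE; [left|right]; exists (numq r, denq r, S, T) => //;
  rewrite /solution_point -rE -yE' xE yE ?mul1r ?mulN1r.
Qed.

Theorem theorem3 (p q : nat) (p_prime : prime p) (q_prime : prime q)
    (q_sub_p : (q - p = 2)%N) :
  (n2K_neg p q <> 0%E -> exists s, primary_solution p q s) /\
  ((n2K_neg p q <= nI p q)%E /\
   (n2K_neg p q = +oo%E -> infinite_set (primary_solution p q))).
Proof.
have pq : (p < q)%N by rewrite -subn_gt0 q_sub_p.
have cover := double_neg_points_cover p_prime q_prime pq.
have le_n : (n2K_neg p q <= nI p q)%E := ecard_cover2_le cover.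
split; last split=> //.
- have [[P /cover DP] _|no] := pselect (double_neg_points p q !=set0).
    by case: DP => -[s [sol _] _]; exists s.
  case; rewrite /n2K_neg (_ : double_neg_points p q = set0); last first.
    by apply/eqP; apply: contra_notT no => /set0P.
  by rewrite /ecard asboolT// fset_set0 mule0.
- move=> n_oo fin; move: le_n; rewrite n_oo leye_eq /nI /ecard asboolT//.
  by apply: sub_finite_set fin => s [].
Qed.
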